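(* Let $(X,E)$ be a finite connected weighted graph with weights $\mu,g$, let $q:X\to\mathbb{R}$ be a potential, and let $B\subset X$ be a nonempty subset. Assume that $(X,E)$ satisfies the Two-Points Condition with respect to $B$. Then the interior spectral data on $B$ of the Schrödinger operator $-\Delta_X+q$ determine the graph $(X,E)$ within the class of such graphs. Precisely: let $(X',E')$ be another finite connected weighted graph with weights $\mu',g'$, potential $q':X'\to\mathbb{R}$ and nonempty subset $B'\subset X'$ such that $(X',E')$ satisfies the Two-Points Condition with respect to $B'$. Suppose that the two interior spectral data coincide via a bijection $\Phi_0:B\to B'$. Then there exists a graph isomorphism $\Phi:(X,E)\to(X',E')$ with $\Phi|_B=\Phi_0$. Furthermore, $\Phi$ can be chosen so that the following conclusions hold. (1) If $\mu$ is given by the degree (or is a constant), then the weights and the potential are uniquely recovered. That is, if either $\mu_x=\deg(x)$ for all $x\in X$ and $\mu'_{x'}=\deg(x')$ for all $x'\in X'$, or both $\mu$ and $\mu'$ are constant functions, then $\mu'_{\Phi(x)}=\mu_x$ and $q'(\Phi(x))=q(x)$ for all $x\in X$, and $g'_{\Phi(x)\Phi(y)}=g_{xy}$ for all $\{x,y\}\in E$. (2) If $q=0$, then the weights are uniquely recovered. That is, if $q\equiv 0$ and $q'\equiv 0$, then $\mu'_{\Phi(x)}=\mu_x$ for all $x\in X$ and $g'_{\Phi(x)\Phi(y)}=g_{xy}$ for all $\{x,y\}\in E$.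
   Context: Graphs are finite, undirected and simple (no loops, no multiple edges). $x\sim y$ means $\{x,y\}\in E$. A weighted graph carries a measure $\mu_x>0$ on each vertex and a symmetric weight $g_{xy}=g_{yx}>0$ on each edge. The graph Laplacian is $(\Delta_X u)(x)=\frac{1}{\mu_x}\sum_{y\sim x}g_{xy}(u(y)-u(x))$, $x\in X$, for $u:X\to\mathbb{R}$, and it is self-adjoint for the inner product $\langle u_1,u_2\rangle_{L^2(X)}=\sum_{x\in X}\mu_x u_1(x)u_2(x)$. Interior spectral data on $B$: $(B,\lambda_j,\phi_j|_B)_{j=1}^{|X|}$, where $\{\phi_j\}_{j=1}^{|X|}$ is a complete $L^2(X)$-orthonormal family of eigenfunctions, $-\Delta_X\phi_j+q\phi_j=\lambda_j\phi_j$ on all of $X$. The interior spectral data of $(X,E,\mu,g,q,B)$ and $(X',E',\mu',g',q',B')$ coincide via a bijection $\Phi_0:B\to B'$ if $|X|=|X'|$ and there are such orthonormal families $\{\phi_j\}$, $\{\phi'_j\}$ with eigenvalues $\lambda_j,\lambda'_j$ such that $\lambda_j=\lambda'_j$ and $\phi_j|_B=\phi'_j\circ\Phi_0$ for all $j$. The graph distance between two vertices is the minimal number of edges of a path joining them. Given $S\subset X$, a point $x_0\in S$ is an extreme point of $S$ with respect to $B$ if there exists $b\in B$ (possibly $b=x_0$) such that $x_0$ is the unique nearest point in $S$ from $b$ with respect to the graph distance on $(X,E)$. $(X,E)$ satisfies the Two-Points Condition with respect to $B$ if every subset $S\subset X$ with cardinality at least $2$ has at least two extreme points with respect to $B$.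 *)

(* Defs.v *)
From mathcomp Require Import all_boot all_order all_algebra.
From mathcomp Require Import reals.
Set Implicit Arguments.
Unset Strict Implicit.
Unset Printing Implicit Defensive.
Import Order.TTheory GRing.Theory Num.Theory.
Local Open Scope ring_scope.

(* [weight] is total, but its values off the edges are junk: nothing is assumed
   about them and no definition below reads them. *)
Record wgraph (R : realType) (X : finType) := WGraph {
  adj : rel X;
  adj_sym : symmetric adj;
  adj_irr : irreflexive adj;
  meas : X -> R;
  meas_gt0 : forall x, 0 < meas x;
  weight : X -> X -> R;
  weight_sym : forall x y, adj x y -> weight x y = weight y x;
  weight_gt0 : forall x y, adj x y -> 0 < weight x y }.

Section Graph.
Variables (R : realType) (X : finType) (G : wgraph R X).

Definition connected_graph : Prop := forall x y, connect (adj G) x y.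

Definition deg (x : X) : nat := #|[set y | adj G x y]|.

Definition laplacian (u : X -> R) (x : X) : R :=
  (meas G x)^-1 * \sum_(y | adj G x y) weight G x y * (u y - u x).

Definition inner (u v : X -> R) : R := \sum_x meas G x * u x * v x.

Definition walk_of_length (x y : X) (n : nat) : bool :=
  [exists p : n.-tuple X, path (adj G) x p && (last x p == y)].

(* Least length of a walk from x to y. Searching below #|X| is enough, since a
   shortest walk has no repeated vertex (see [gdistP]); the value is #|X| when y
   is not reachable from x. *)
Definition gdist (x y : X) : nat := find (walk_of_length x y) (iota 0 #|X|).

Definition extreme_point (B S : {set X}) (x0 : X) : bool :=
  (x0 \in S) &&
  [exists b in B, [forall y in S, (y != x0) ==> (gdist b x0 < gdist b y)%N]].

Definition two_points (B : {set X}) : Prop :=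
  forall S : {set X}, (2 <= #|S|)%N ->
    (2 <= #|[set x | extreme_point B S x]|)%N.

(* No ordering of the eigenvalues is imposed. *)
Definition eigenfamily (q : X -> R) (n : nat)
    (lam : 'I_n -> R) (phi : 'I_n -> X -> R) : Prop :=
  [/\ forall i j, inner (phi i) (phi j) = (i == j)%:R,
      forall u : X -> R, exists c : 'I_n -> R,
        forall x, u x = \sum_j c j * phi j x
    & forall j x,
        - laplacian (phi j) x + q x * phi j x = lam j * phi j x].

Lemma gdistP (x y : X) : connect (adj G) x y ->
  (exists p, [/\ path (adj G) x p, last x p = y & size p = gdist x y]) /\
  (forall p, path (adj G) x p -> last x p = y -> (gdist x y <= size p)%N).
Proof.
have walkP n : reflect (exists p, [/\ path (adj G) x p, last x p = y & size p = n])
                       (walk_of_length x y n).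
  apply: (iffP existsP) => [[p /andP[pp /eqP lp]]|[p [pp lp sp]]].
    by exists p; rewrite size_tuple.
  by move/eqP: sp => sp; exists (Tuple sp); rewrite /= pp lp eqxx.
move=> /connectP[p0 pp0 y_def].
have has_walk : has (walk_of_length x y) (iota 0 #|X|).
  case/shortenP: pp0 y_def => p pp up _ y_def; apply/hasP; exists (size p).
    by rewrite mem_iota add0n -[(size p).+1]/(size (x :: p)) -(card_uniqP up) max_card.
  by apply/walkP; exists p; split.
have dlt : (gdist x y < #|X|)%N by move: has_walk; rewrite has_find size_iota.
split.
  apply/walkP; have := nth_find 0%N has_walk.
  by rewrite nth_iota.
move=> p pp lp; rewrite leqNgt; apply/negP => lt_pd.
have := before_find 0%N lt_pd; rewrite nth_iota ?(ltn_trans lt_pd) //.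
by rewrite add0n => /negbT/walkP; apply; exists p.
Qed.

End Graph.

Definition graph_iso (R : realType) (X X' : finType)
    (G : wgraph R X) (G' : wgraph R X') (Phi : X -> X') : Prop :=
  bijective Phi /\ forall x y, adj G x y = adj G' (Phi x) (Phi y).

Definition spectral_data_coincide (R : realType) (X X' : finType)
    (G : wgraph R X) (G' : wgraph R X') (q : X -> R) (q' : X' -> R)
    (B : {set X}) (B' : {set X'})
    (Phi0 : {x | x \in B} -> {x' | x' \in B'}) : Prop :=
  #|X| = #|X'| /\
  exists (lam lam' : 'I_#|X| -> R)
         (phi : 'I_#|X| -> X -> R) (phi' : 'I_#|X| -> X' -> R),
    [/\ eigenfamily G q lam phi,
        eigenfamily G' q' lam' phi',
        forall j, lam j = lam' j
      & forall j (b : {x | x \in B}), phi j (val b) = phi' j (val (Phi0 b))].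

(* Main.v *)
Require Import Defs.
From mathcomp Require Import all_boot all_order all_algebra.
From mathcomp Require Import reals ring lra.
Set Implicit Arguments.
Unset Strict Implicit.
Unset Printing Implicit Defensive.
Import Order.TTheory GRing.Theory Num.Theory.
Local Open Scope ring_scope.

(** Write A for the Schroedinger operator of G and A' for that of G'. The
    families [phi] and [phi'] have the same eigenvalues, so sending [phi j] to
    [phi' j] is a unitary map W from L^2(X) to L^2(X') with W A = A' W. Since the
    families agree on B, W maps the Dirac mass at b to the Dirac mass at Phi0 b,
    for b in B. All the objects involved are kernels
    sum_j lam_j^k phi_j(x) psi_j(y) ([kern]): with [psi := phi] this is the
    kernel of A^k, with [psi := phi'] and k = 0 it is the kernel a(x, y) of W,
    and orthonormality of the middle family turns composition of kernels into
    addition of exponents ([kern_comp]).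

    The heart of the proof is that W is monomial: each row a(x, .) has exactly
    one nonzero entry ([all_matched]). Finite speed of propagation says that
    A^k(b, x) vanishes for k < d(b, x) and has the sign (-1)^k for k = d(b, x)
    ([kern_far], [kern_front]). Suppose that some rows are not monomial. By
    orthogonality the monomial rows and columns split off, and the Two-Points
    Condition gives an extreme point x0 of the set C of remaining vertices: some
    b in B has x0 as its unique nearest point of C, at distance m say. Among the
    rows of C, A^m(b, .) sees only that of x0, so on the remaining columns the
    row a(x0, .) is a positive multiple of (-1)^m A'^m(Phi0 b, .). The columns
    are at distance at least m from Phi0 b, because A'^k(Phi0 b, .) vanishes
    there for k < m. Hence a(x0, .) is nonnegative ([unmatched_row_ge0]).

    A nonnegative row cannot produce cancellation, so the time at which its
    signal reaches any point of B' is exactly the distance to its support. That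
    time is read off in G as the distance to x0, so each y in the support is at
    least as far from the observed points as x0 is ([row_support_far]). Now let
    S be the support of the column a(., y). If it had two points, it would have
    an extreme point other than x0, closer to some b than x0 is, whose signal
    would reach b before that of y does: impossible. So S = {x0}, and
    orthogonality of columns makes the row of x0 monomial ([far_matched]), a
    contradiction.

    Let Phi x be the column of the nonzero entry of row x. Then A'(Phi x, Phi y)
    is A(x, y) up to nonzero factors, which gives the graph isomorphism
    ([matching_adj]) and, as edge weights are positive, propagates the sign of
    a(x, Phi x) from B to the whole graph ([alpha_gt0]). Once the measures agree,
    unitarity and positivity determine a(x, Phi x), hence weights and potential
    ([recovery_of_meas]). The measures agree at observed vertices, which settles
    constant measures, while degrees are invariant under isomorphism. If both
    potentials vanish, pairing W with the constant function 1, a null vector of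
    A', gives a harmonic function on G, which is constant; its value at an
    observed vertex is 1, and this forces the measures to agree
    ([meas_of_free]). *)

(** * Spectral kernels *)
Section Kernels.
Variables (R : realType) (n : nat) (lam : 'I_n -> R).

(** Two families are allowed so that powers of either operator and the unitary
    map between them are instances of the same expression. *)
Definition kern (X Y : finType) (phi : 'I_n -> X -> R) (psi : 'I_n -> Y -> R)
    (k : nat) (x : X) (y : Y) : R :=
  \sum_j lam j ^+ k * (phi j x * psi j y).

Lemma kernC (X Y : finType) (phi : 'I_n -> X -> R) (psi : 'I_n -> Y -> R) k x y :
  kern phi psi k x y = kern psi phi k y x.
Proof. by apply: eq_bigr => j _; rewrite [phi j x * _]mulrC. Qed.

Lemma kern_eql (X X' Y : finType) (phi : 'I_n -> X -> R) (phi' : 'I_n -> X' -> R)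
    (psi : 'I_n -> Y -> R) x x' k y :
  (forall j, phi j x = phi' j x') -> kern phi psi k x y = kern phi' psi k x' y.
Proof. by move=> e; apply: eq_bigr => j _; rewrite e. Qed.

(** Composing kernels multiplies the operators they represent; the family in
    the middle enters only through its orthonormality. *)
Lemma kern_comp (X Y Z : finType) (G : wgraph R Y) (phi : 'I_n -> X -> R)
    (psi : 'I_n -> Y -> R) (chi : 'I_n -> Z -> R) k l x z :
  (forall i j, inner G (psi i) (psi j) = (i == j)%:R) ->
  \sum_y meas G y * (kern phi psi k x y * kern psi chi l y z)
    = kern phi chi (k + l) x z.
Proof.
move=> ortho.
transitivity (\sum_i \sum_j (lam i ^+ k * phi i x) * (lam j ^+ l * chi j z)
                * inner G (psi i) (psi j)).
  under eq_bigr => y _ do rewrite /kern big_distrlr mulr_sumr.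
  rewrite exchange_big; apply: eq_bigr => i _.
  under eq_bigr => y _ do rewrite mulr_sumr.
  rewrite exchange_big; apply: eq_bigr => j _.
  rewrite /inner mulr_sumr; apply: eq_bigr => y _ /=. ring.
apply: eq_bigr => i _; rewrite (bigD1 i) //= big1 ?addr0 => [|j ji].
  by rewrite ortho eqxx mulr1 exprD; ring.
by rewrite ortho eq_sym (negPf ji) mulr0.
Qed.

End Kernels.

(** * Graph distance and finite propagation speed *)
Section Distance.
Variables (R : realType) (X : finType) (G : wgraph R X).
Hypothesis conn : connected_graph G.

Lemma gdist_eq0 x y : (gdist G x y == 0%N) = (x == y).
Proof.
have [[p [pp lp sp]] ub] := gdistP (conn x y).
apply/eqP/eqP => [d0|exy].
  by move: sp lp; rewrite d0 => /size0nil ->.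
by apply/eqP; rewrite -leqn0; apply: (ub [::]).
Qed.

Lemma gdist_adj x w y : adj G x w -> (gdist G x y <= (gdist G w y).+1)%N.
Proof.
move=> xw; have [[p [pp lp <-]] _] := gdistP (conn w y).
by apply: (gdistP (conn x y)).2 (w :: p) _ lp; rewrite /= xw.
Qed.

Lemma gdist_succ x y k : gdist G x y = k.+1 ->
  exists2 w, adj G x w & gdist G w y = k.
Proof.
have [[p [pp lp sp]] _] := gdistP (conn x y) => dk.
case: p pp lp sp => [|w p] /=; first by rewrite dk.
rewrite dk => /andP[xw pp] lp [sp]; exists w => //.
apply/eqP; rewrite eqn_leq; apply/andP; split; last by rewrite -ltnS -dk gdist_adj.
by rewrite -sp; apply: (gdistP (conn w y)).2.
Qed.

End Distance.

Section Propagation.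
Variables (R : realType) (X : finType) (G : wgraph R X) (q : X -> R).
Variables (n : nat) (lam : 'I_n -> R) (phi : 'I_n -> X -> R).
Hypothesis eig : eigenfamily G q lam phi.

Local Notation K := (kern lam phi phi).

(** Completeness: expanding the indicator of y in the family gives the
    coefficients mu_y phi_i(y), and evaluating the expansion at x gives the
    kernel of the identity. *)
Lemma kern0 x y : K 0 x y = (x == y)%:R / meas G y.
Proof.
case: eig => ortho span _; have [c cE] := span (fun z => (z == y)%:R).
have my := lt0r_neq0 (meas_gt0 G y).
have cv i : c i = meas G y * phi i y.
  have <- : inner G (fun z => (z == y)%:R) (phi i) = meas G y * phi i y.
    rewrite /inner (bigD1 y) //= big1 ?addr0 ?eqxx ?mulr1 // => z zy.
    by rewrite (negPf zy) mulr0 mul0r.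
  rewrite /inner; under eq_bigr => z _ do rewrite cE mulr_sumr mulr_suml.
  rewrite exchange_big /= (bigD1 i) //= [X in _ + X]big1 ?addr0 => [|j ji].
    transitivity (c i * inner G (phi i) (phi i)).
      by rewrite ortho eqxx mulr1.
    rewrite /inner mulr_sumr. by apply: eq_bigr => z _; ring.
  transitivity (c j * inner G (phi j) (phi i)).
    rewrite /inner mulr_sumr. by apply: eq_bigr => z _; ring.
  by rewrite ortho (negPf ji) mulr0.
apply: (mulIf my); rewrite divfK // cE /kern mulr_suml.
by apply: eq_bigr => j _; rewrite cv expr0; ring.
Qed.

Lemma schrodingerE (u : X -> R) x :
  - laplacian G u x + q x * u x
    = (q x + (meas G x)^-1 * \sum_(y | adj G x y) weight G x y) * u x
      - (meas G x)^-1 * \sum_(y | adj G x y) weight G x y * u y.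
Proof.
rewrite /laplacian; under eq_bigr => y _ do rewrite mulrBr.
by rewrite sumrB -mulr_suml; ring.
Qed.

(** Raising the exponent applies the operator in the first variable. The second
    family is arbitrary so that this also expresses the intertwining of the two
    operators. *)
Lemma kernS (Y : finType) (psi : 'I_n -> Y -> R) k x y :
  kern lam phi psi k.+1 x y
    = - laplacian G (kern lam phi psi k ^~ y) x + q x * kern lam phi psi k x y.
Proof.
case: eig => _ _ eigE; rewrite schrodingerE.
under [X in _ - _ * X]eq_bigr => z _ do rewrite /kern mulr_sumr.
rewrite exchange_big !mulr_sumr -sumrB; apply: eq_bigr => j _.
transitivity (lam j ^+ k * psi j y * (lam j * phi j x)); first by rewrite exprS; ring.
rewrite -eigE schrodingerE mulrBr !mulr_sumr; congr (_ - _); first by ring.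
by apply: eq_bigr => z _; ring.
Qed.

Hypothesis conn : connected_graph G.

(** One application of the operator reaches only neighbours, so k applications
    do not leave the ball of radius k. *)
Lemma kern_far k x y : (k < gdist G x y)%N -> K k x y = 0.
Proof.
elim: k x => [|k IH] x kd.
  by rewrite kern0 -(gdist_eq0 conn) -[_ == _]negbK -lt0n kd mul0r.
rewrite kernS schrodingerE IH ?(ltn_trans _ kd) // mulr0 sub0r big1 ?mulr0 ?oppr0 //.
move=> z xz; rewrite IH ?mulr0 //.
by rewrite -ltnS (leq_trans kd) // gdist_adj.
Qed.

(** At time d(x, y) only shortest walks contribute, and each step of such a
    walk carries the negative off-diagonal coefficient - g / mu; hence no
    cancellation is possible and the sign alternates with time. *)
Lemma kern_front x y : 0 < (-1) ^+ gdist G x y * K (gdist G x y) x y.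
Proof.
move dk: (gdist G x y) => k; elim: k x dk => [|k IH] x dk.
  have /eqP -> : x == y by rewrite -(gdist_eq0 conn) dk.
  by rewrite kern0 eqxx expr0 !mul1r invr_gt0 meas_gt0.
rewrite kernS schrodingerE kern_far ?dk // mulr0 sub0r exprS mulN1r mulrNN.
rewrite mulrCA mulr_gt0 ?invr_gt0 ?meas_gt0 // mulr_sumr.
have [w xw dw] := gdist_succ conn dk.
rewrite (bigD1 w) //= ltr_pwDl //.
  by rewrite mulrCA mulr_gt0 ?weight_gt0 ?IH.
apply: sumr_ge0 => z /andP[xz _]; rewrite mulrCA mulr_ge0 ?(ltW (weight_gt0 xz)) //.
have : (k <= gdist G z y)%N by rewrite -ltnS -dk gdist_adj.
rewrite leq_eqVlt => /orP[/eqP kz|/kern_far ->]; last by rewrite mulr0.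
by rewrite ltW // IH.
Qed.

Lemma kern_front_neq0 x y : K (gdist G x y) x y != 0.
Proof.
by apply: contraTneq (kern_front x y) => ->; rewrite mulr0 ltxx.
Qed.

Lemma kern_near_ge0 k x y : (k <= gdist G x y)%N -> 0 <= (-1) ^+ k * K k x y.
Proof.
rewrite leq_eqVlt => /orP[/eqP ->|/kern_far ->]; last by rewrite mulr0.
by rewrite ltW // kern_front.
Qed.

Lemma kern1_off x y : x != y ->
  K 1 x y = - (adj G x y)%:R * (weight G x y / (meas G x * meas G y)).
Proof.
move=> xy; have mx := lt0r_neq0 (meas_gt0 G x); have my := lt0r_neq0 (meas_gt0 G y).
rewrite kernS schrodingerE kern0 (negPf xy) mul0r mulr0 sub0r.
have -> : \sum_(z | adj G x z) weight G x z * K 0 z y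
            = (adj G x y)%:R * (weight G x y / meas G y).
  rewrite big_mkcond (bigD1 y) //= kern0 eqxx mul1r big1 ?addr0 => [|z zy].
    by case: adj; rewrite ?mul0r ?mul1r.
  by rewrite kern0 (negPf zy) mul0r mulr0; case: ifP.
by field; rewrite mx my.
Qed.

Lemma kern1_off_eq0 x y : x != y -> (K 1 x y == 0) = ~~ adj G x y.
Proof.
move=> xy; rewrite (kern1_off xy); case A: adj; last by rewrite oppr0 mul0r eqxx.
rewrite mulN1r oppr_eq0 mulf_eq0 invr_eq0 mulf_eq0.
by rewrite !gt_eqF ?meas_gt0 ?weight_gt0.
Qed.

Lemma kern1_diag x :
  K 1 x x = (q x + (meas G x)^-1 * \sum_(y | adj G x y) weight G x y) / meas G x.
Proof.
rewrite kernS schrodingerE kern0 eqxx mul1r [X in _ - _ * X]big1 ?mulr0 ?subr0 // => z xz.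
by rewrite kern0; case: eqP xz => [->|_ _]; rewrite ?adj_irr ?mul0r ?mulr0.
Qed.

End Propagation.

(** Maximum principle: at a maximum the differences to the neighbours are all
    nonpositive with weighted sum zero, so the maximal value spreads along
    walks. *)
Lemma harmonic_const (R : realType) (X : finType) (G : wgraph R X) (u : X -> R) :
  connected_graph G -> (forall x, laplacian G u x = 0) -> forall x y, u x = u y.
Proof.
move=> conn harm x0 y0.
have [m _ mP] := @arg_maxP _ _ X x0 xpredT u isT.
suff um z : u z = u m by rewrite !um.
have /connectP[p pp ->] := conn m z.
elim/last_ind: p pp => // p w IH; rewrite rcons_path last_rcons => /andP[/IH um xw].
set x := last m p in um xw *.
have /eqP : laplacian G u x = 0 by [].
rewrite /laplacian mulf_eq0 invr_eq0 (negPf (lt0r_neq0 (meas_gt0 G x))) /=.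
rewrite -oppr_eq0 -sumrN psumr_eq0 => [/allP/(_ w)|y xy].
  rewrite mem_index_enum xw oppr_eq0 mulf_eq0 (negPf (lt0r_neq0 (weight_gt0 xw))).
  by rewrite subr_eq0 um => /(_ isT)/eqP.
rewrite oppr_ge0 mulr_ge0_le0 ?(ltW (weight_gt0 xy)) // subr_le0 um.
exact: mP.
Qed.

(** * The unitary map between the two graphs is monomial *)
Section Coupling.
Variables (R : realType) (X X' : finType) (G : wgraph R X) (G' : wgraph R X').
Variables (q : X -> R) (q' : X' -> R).
Variables (n : nat) (lam : 'I_n -> R) (phi : 'I_n -> X -> R) (phi' : 'I_n -> X' -> R).
Hypothesis eig : eigenfamily G q lam phi.
Hypothesis eig' : eigenfamily G' q' lam phi'.

Local Notation K := (kern lam phi phi).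
Local Notation K' := (kern lam phi' phi').
Local Notation a := (kern lam phi phi' 0).

Lemma ortho_family : forall i j, inner G (phi i) (phi j) = (i == j)%:R.
Proof. by case: eig. Qed.

Lemma ortho_family' : forall i j, inner G' (phi' i) (phi' j) = (i == j)%:R.
Proof. by case: eig'. Qed.

(** This and [coupling_cols] express that the map with kernel [a] is unitary
    for the two weighted inner products. *)
Lemma coupling_rows x y :
  \sum_z meas G' z * (a x z * a y z) = (x == y)%:R / meas G y.
Proof.
rewrite -(kern0 eig) -(kern_comp lam phi phi 0 0 x y ortho_family').
by apply: eq_bigr => z _; rewrite [kern _ phi' _ _ _ _]kernC.
Qed.

Lemma coupling_cols x y :
  \sum_z meas G z * (a z x * a z y) = (x == y)%:R / meas G' y.
Proof.
rewrite -(kern0 eig') -(kern_comp lam phi' phi' 0 0 x y ortho_family).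
by apply: eq_bigr => z _; rewrite [kern _ phi' _ _ _ _]kernC.
Qed.

Lemma intertwining x y :
  \sum_z meas G' z * (a x z * K' 1 z y) = \sum_z meas G z * (K 1 x z * a z y).
Proof. by rewrite !kern_comp //; [apply: ortho_family | apply: ortho_family']. Qed.

(** At a vertex where the two families agree, the signal received from x in G
    is the one received in G' from the image of x, and conversely in
    [kern_transfer_back]. *)
Lemma kern_transfer k b b' x : (forall j, phi j b = phi' j b') ->
  K k b x = \sum_y meas G' y * (a x y * K' k b' y).
Proof.
move=> e; rewrite (kern_eql lam phi k x e) kernC -[k]add0n.
rewrite -(kern_comp lam phi phi' 0 k x b' ortho_family').
by apply: eq_bigr => y _; rewrite [kern _ _ _ k y _]kernC.
Qed.

Lemma kern_transfer_back k b b' y : (forall j, phi j b = phi' j b') ->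
  K' k b' y = \sum_x meas G x * (a x y * K k b x).
Proof.
move=> e; rewrite -(kern_eql lam phi' k y e) -[k]addn0.
rewrite -(kern_comp lam phi phi' k 0 b y ortho_family) addn0.
by apply: eq_bigr => x _; rewrite [a x y * _]mulrC.
Qed.

Definition matched x y := (a x y != 0) && [forall z, (z != y) ==> (a x z == 0)].

Lemma matched_row x y z : matched x y -> z != y -> a x z = 0.
Proof. by case/andP => _ /forallP/(_ z)/implyP h /h/eqP. Qed.

(** Row z is orthogonal to row x, and the product of the two rows is supported
    at the only nonzero entry of row x. *)
Lemma matched_col x y z : matched x y -> z != x -> a z y = 0.
Proof.
move=> mxy zx; have := coupling_rows x z.
rewrite eq_sym (negPf zx) mul0r (bigD1 y) //= big1 ?addr0 => [/eqP|t ty].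
  rewrite !mulf_eq0 (negPf (lt0r_neq0 (meas_gt0 _ _))) /=.
  by case/andP: mxy => /negPf -> _ /eqP.
by rewrite (matched_row mxy ty) mul0r mulr0.
Qed.

Hypothesis conn : connected_graph G.
Hypothesis conn' : connected_graph G'.
Variable B : {set X}.
Hypothesis Bn0 : B != set0.
Hypothesis twop : two_points G B.
Hypothesis seen : forall b, b \in B -> exists b', forall j, phi j b = phi' j b'.

Lemma extreme_witness (S : {set X}) x : extreme_point G B S x ->
  exists2 b, b \in B & forall y, y \in S -> y != x -> (gdist G b x < gdist G b y)%N.
Proof.
case/andP=> _ /existsP[b /andP[bB /forallP h]]; exists b => // y yS yx.
by have := h y; rewrite yS yx.
Qed.

(** For a singleton every b in B serves as a witness; larger sets are the
    Two-Points Condition. *)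
Lemma extreme_exists (S : {set X}) : S != set0 -> exists x, x \in S /\
  exists2 b, b \in B & forall y, y \in S -> y != x -> (gdist G b x < gdist G b y)%N.
Proof.
rewrite -card_gt0 leq_eqVlt => /orP[|S2].
  rewrite eq_sym => /cards1P[x ->]; exists x; rewrite set11; split=> //.
  by have /set0Pn[b bB] := Bn0; exists b => // y /set1P ->; rewrite eqxx.
have /card_gt0P[x] : (0 < #|[set x | extreme_point G B S x]|)%N.
  by apply: leq_trans (twop S2).
rewrite inE => ex; exists x; split; first by case/andP: ex.
exact: extreme_witness ex.
Qed.

(** If the column of y is supported in S and all points of S except x are too
    far to reach b by time k, then what y sends to the observed vertex at time
    k is the contribution of x alone. *)
Lemma sole_contribution (S : {set X}) b b' x y k :
  (forall j, phi j b = phi' j b') ->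
  (forall z, z \notin S -> a z y = 0) ->
  (forall z, z \in S -> z != x -> (k < gdist G b z)%N) ->
  K' k b' y = meas G x * (a x y * K k b x).
Proof.
move=> e off far; rewrite (kern_transfer_back _ _ e) (bigD1 x) //= big1 ?addr0 // => z zx.
have [zS|zS] := boolP (z \in S); last by rewrite off // mul0r mulr0.
by rewrite (kern_far eig conn (far z zS zx)) !mulr0.
Qed.

(** On the unmatched columns the row of x is a positive multiple of
    (-1)^m A'^m(b', .) with m = d(b, x), because x is the only unmatched vertex
    within reach of b at time m; these columns are themselves at distance at
    least m from b', which is where that kernel has a constant sign. *)
Lemma unmatched_row_ge0 x : (forall y, ~~ matched x y) ->
  (exists2 b, b \in B & forall z, (forall y, ~~ matched z y) -> z != x ->
     (gdist G b x < gdist G b z)%N) ->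
  forall y, 0 <= a x y.
Proof.
move=> xU [b bB bx] y; have [b' e] := seen bB.
have [/existsP[t ty]|/existsPn yU] := boolP [exists t, matched t y].
  (* A matched column vanishes on every other row, in particular on that of x. *)
  rewrite (matched_col ty) //; apply: contraTneq ty => <-; exact: xU.
pose C := [set z | ~~ [exists t, matched z t]].
have CP z : reflect (forall t, ~~ matched z t) (z \in C).
  by rewrite inE negb_exists; apply: forallP.
have sole k : (k <= gdist G b x)%N -> K' k b' y = meas G x * (a x y * K k b x).
  move=> km; apply: (@sole_contribution C) => // [z|z /CP zU zx].
  - rewrite inE negbK => /existsP[t zt]; apply: (matched_row zt).
    by apply: contraTneq zt => <-; apply: yU.
  - exact: leq_ltn_trans km (bx z zU zx).
(* If y were closer than m to b', its signal would be nonzero at a time when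
   that of x is still zero. *)
have near : (gdist G b x <= gdist G' b' y)%N.
  rewrite leqNgt; apply: contraL (kern_front_neq0 eig' conn' b' y) => lt.
  by rewrite sole ?(ltnW lt) // (kern_far eig conn lt) !mulr0 eqxx.
have := kern_near_ge0 eig' conn' near; rewrite sole // mulrCA [_ ^+ _ * _]mulrCA mulrCA pmulr_lge0 //.
by rewrite mulr_gt0 ?meas_gt0 //; apply: kern_front eig conn b x.
Qed.

(** Signals of a nonnegative row cannot cancel: the first one to reach b' comes
    from the nearest point y0 of the support, and it is also the signal that x
    sends to b, which takes time d(b, x). *)
Lemma row_support_far x y b b' : (forall z, 0 <= a x z) -> a x y != 0 ->
  (forall j, phi j b = phi' j b') -> (gdist G b x <= gdist G' b' y)%N.
Proof.
move=> ge0 axy e; have [y0 ay0 minP] := arg_minnP (gdist G' b') (P := fun z => a x z != 0) axy.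
apply: leq_trans (minP y axy); rewrite leqNgt; apply/negP => lt.
have a0 : 0 < a x y0 by rewrite lt0r ay0 ge0.
set k := gdist G' b' y0 in lt minP.
suff : 0 < (-1) ^+ k * K k b x by rewrite (kern_far eig conn lt) mulr0 ltxx.
rewrite (kern_transfer _ _ e) mulr_sumr (bigD1 y0) //= ltr_pwDl //.
  rewrite mulrCA mulr_gt0 ?meas_gt0 // mulrCA mulr_gt0 //.
  exact: kern_front eig' conn' b' y0.
apply: sumr_ge0 => z _; rewrite mulrCA mulr_ge0 ?(ltW (meas_gt0 _ _)) // mulrCA.
have [->|az] := eqVneq (a x z) 0; first by rewrite mul0r.
by rewrite mulr_ge0 ?ge0 // (kern_near_ge0 eig' conn') // minP.
Qed.

(** If the column of y had another point besides x in its support, the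
    Two-Points Condition would give an extreme point w other than x, nearer to
    some b than x is. The signal of w at b at time d(b, w) would then be a
    nonzero signal of y at b' earlier than d(b', y). *)
Lemma far_matched x y : a x y != 0 ->
  (forall b b', (forall j, phi j b = phi' j b') -> (gdist G b x <= gdist G' b' y)%N) ->
  matched x y.
Proof.
move=> axy far; pose S := [set z | a z y != 0].
have xS : x \in S by rewrite inE.
have col z : z != x -> a z y = 0.
  move=> zx; apply/eqP/negPn/negP => azy.
  have S2 : (2 <= #|S|)%N.
    rewrite (cardsD1 x) xS ltnS; apply/card_gt0P; exists z.
    by rewrite !inE zx azy.
  have /card_gt0P[w] : (0 < #|[set w | extreme_point G B S w] :\ x|)%N.
    have := twop S2; rewrite (cardsD1 x); case: (_ \in _) => // /ltnW; exact.
  rewrite !inE => /andP[wx ew]; have wS : w \in S by case/andP: ew.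
  have [b bB bw] := extreme_witness ew; have [b' e] := seen bB.
  have := kern_far eig' conn' (leq_trans (bw x xS _) (far b b' e)).
  rewrite eq_sym wx (@sole_contribution S b b' w) //.
    move=> /(_ isT)/eqP; rewrite !mulf_eq0 (negPf (lt0r_neq0 (meas_gt0 _ _))).
    rewrite (negPf (kern_front_neq0 eig conn _ _)) orbF /=.
    by apply/negP; rewrite inE in wS.
  by move=> t; rewrite inE negbK => /eqP.
rewrite /matched axy; apply/forallP => t; apply/implyP => ty.
have := coupling_cols t y; rewrite (negPf ty) mul0r (bigD1 x) //= big1 ?addr0 => [|z zx].
  move/eqP; rewrite !mulf_eq0 (negPf axy) orbF.
  by rewrite (negPf (lt0r_neq0 (meas_gt0 _ _))).
by rewrite (col z zx) !mulr0.
Qed.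

Lemma row_neq0 x : exists y, a x y != 0.
Proof.
apply/existsP; apply: contraT => /existsPn row0.
have := coupling_rows x x; rewrite big1 => [/esym/eqP|z _].
  by rewrite eqxx mul1r invr_eq0 (negPf (lt0r_neq0 (meas_gt0 _ _))).
by have := row0 z; rewrite negbK => /eqP ->; rewrite mul0r mulr0.
Qed.

(** The unmatched vertices, if there were any, would have an extreme point, and
    that point would be matched after all. *)
Lemma all_matched x : exists y, matched x y.
Proof.
apply/existsP; apply: contraT => xU.
pose C := [set z | ~~ [exists t, matched z t]].
have [|x0 [x0C [b bB bx]]] := @extreme_exists C.
  by apply/set0Pn; exists x; rewrite inE.
have x0U : forall y, ~~ matched x0 y by apply/existsPn; move: x0C; rewrite inE.
have ge0 : forall y, 0 <= a x0 y.
  apply: unmatched_row_ge0 => //; exists b => // z zU; apply: bx.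
  by rewrite inE; apply/existsPn.
have [y ay] := row_neq0 x0.
case/negP: (x0U y); apply: far_matched => // b1 b1'.
exact: row_support_far.
Qed.

End Coupling.

(** * Recovery of the measure, the weights and the potential *)
Section Flux.
Variables (R : realType) (X : finType) (G : wgraph R X).

Lemma laplacian_sum (Y : finType) (c : Y -> R) (f : X -> Y -> R) x :
  laplacian G (fun z => \sum_y c y * f z y) x = \sum_y c y * laplacian G (f ^~ y) x.
Proof.
rewrite /laplacian.
under eq_bigr => z _ do rewrite -sumrB mulr_sumr.
rewrite exchange_big mulr_sumr; apply: eq_bigr => y _.
rewrite !mulr_sumr; apply: eq_bigr => z _; ring.
Qed.

(** The flow along each edge is counted once in each direction, with opposite
    signs. *)
Lemma total_laplacian (u : X -> R) : \sum_x meas G x * laplacian G u x = 0.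
Proof.
have -> : \sum_x meas G x * laplacian G u x
            = \sum_x \sum_(y | adj G x y) weight G x y * (u y - u x).
  by apply: eq_bigr => x _; rewrite /laplacian mulVKf ?lt0r_neq0 ?meas_gt0.
set S := \sum_x _; suff : S = - S by lra.
rewrite {1}/S (exchange_big_dep xpredT) //= -sumrN; apply: eq_bigr => x _.
rewrite -sumrN; apply: eq_big => [y|y yx]; first by rewrite adj_sym.
by rewrite (weight_sym yx) -mulrN opprB.
Qed.

End Flux.

Section Recovery.
Variables (R : realType) (X X' : finType) (G : wgraph R X) (G' : wgraph R X').
Variables (q : X -> R) (q' : X' -> R).
Variables (n : nat) (lam : 'I_n -> R) (phi : 'I_n -> X -> R) (phi' : 'I_n -> X' -> R).
Hypothesis eig : eigenfamily G q lam phi.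
Hypothesis eig' : eigenfamily G' q' lam phi'.
Hypothesis conn : connected_graph G.
Variable Phi : X -> X'.
Hypothesis PhiP : forall x, matched lam phi phi' x (Phi x).

Local Notation K := (kern lam phi phi).
Local Notation K' := (kern lam phi' phi').
Local Notation a := (kern lam phi phi' 0).
Local Notation alpha x := (a x (Phi x)).

Lemma alpha_neq0 x : alpha x != 0.
Proof. by case/andP: (PhiP x). Qed.

Lemma matching_inj : injective Phi.
Proof.
move=> x y e; apply/eqP; apply: contraT; rewrite eq_sym => yx.
by have := alpha_neq0 y; rewrite -e (matched_col eig eig' (PhiP x) yx) eqxx.
Qed.

Lemma alpha_sqr x : meas G x * meas G' (Phi x) * alpha x ^+ 2 = 1.
Proof.
have := coupling_rows eig eig' x x; rewrite (bigD1 (Phi x)) //= big1 ?addr0 => [e|z zx].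
  by rewrite -mulrA expr2 e eqxx mul1r divff ?lt0r_neq0 ?meas_gt0.
by rewrite (matched_row (PhiP x) zx) mul0r mulr0.
Qed.

(** The intertwining relation at (x, Phi z) has a single surviving term on each
    side; the unitarity relation [alpha_sqr] solves it for the kernel of A'. *)
Lemma kern1_matching x z :
  K' 1 (Phi x) (Phi z) = (meas G x * alpha x) * (meas G z * alpha z) * K 1 x z.
Proof.
have := intertwining eig eig' x (Phi z).
rewrite (bigD1 (Phi x)) //= big1 ?addr0 => [|y yx]; last first.
  by rewrite (matched_row (PhiP x) yx) mul0r mulr0.
rewrite (bigD1 z) //= big1 ?addr0 => [|y yz]; last first.
  by rewrite (matched_col eig eig' (PhiP z) yz) !mulr0.
move=> e; rewrite -[LHS]mul1r -(alpha_sqr x).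
transitivity (meas G x * alpha x * (meas G' (Phi x) * (alpha x * K' 1 (Phi x) (Phi z)))).
  by ring.
by rewrite e; ring.
Qed.

Lemma matching_adj x y : adj G x y = adj G' (Phi x) (Phi y).
Proof.
have [->|xy] := eqVneq x y; first by rewrite !adj_irr.
have pxy : Phi x != Phi y by rewrite (inj_eq matching_inj).
apply: negb_inj; rewrite -(kern1_off_eq0 eig xy) -(kern1_off_eq0 eig' pxy).
rewrite kern1_matching !mulf_eq0 !(negPf (alpha_neq0 _)).
by rewrite !(negPf (lt0r_neq0 (meas_gt0 _ _))).
Qed.

Lemma matching_weight x y : adj G x y ->
  weight G' (Phi x) (Phi y)
    = (meas G' (Phi x) * alpha x) * (meas G' (Phi y) * alpha y) * weight G x y.
Proof.
move=> xy; have nxy : x != y by apply: contraTneq xy => ->; rewrite adj_irr.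
have pxy : Phi x != Phi y by rewrite (inj_eq matching_inj).
have := kern1_matching x y; rewrite (kern1_off eig nxy) (kern1_off eig' pxy).
rewrite -matching_adj xy !mulN1r mulrN => /oppr_inj e.
have mu0 := lt0r_neq0 (meas_gt0 G _); have mu0' := lt0r_neq0 (meas_gt0 G' _).
apply: (mulIf (invr_neq0 (mulf_neq0 (mu0' (Phi x)) (mu0' (Phi y))))).
by rewrite e; field; rewrite !mu0 !mu0'.
Qed.

Section Observed.
Variables (b : X) (b' : X').
Hypothesis e : forall j, phi j b = phi' j b'.

Lemma coupling_observed y : a b y = (b' == y)%:R / meas G' y.
Proof. by rewrite (kern_eql lam phi' 0 y e) (kern0 eig'). Qed.

Lemma matching_observed : Phi b = b'.
Proof.
have := alpha_neq0 b; rewrite coupling_observed.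
by case: (b' =P Phi b) => [->|_] //; rewrite mul0r eqxx.
Qed.

Lemma alpha_observed : meas G' (Phi b) * alpha b = 1.
Proof.
by rewrite coupling_observed matching_observed eqxx mul1r divff ?lt0r_neq0 ?meas_gt0.
Qed.

Lemma meas_observed : meas G' (Phi b) = meas G b.
Proof.
rewrite -[LHS]mulr1 -(alpha_sqr b).
transitivity (meas G b * (meas G' (Phi b) * alpha b) ^+ 2); first by ring.
by rewrite alpha_observed expr1n mulr1.
Qed.

(** The weights of an edge and of its image are both positive, so by
    [matching_weight] the signs of [alpha] at adjacent vertices agree. *)
Lemma alpha_gt0 x : 0 < alpha x.
Proof.
have ab : 0 < alpha b.
  by rewrite -(pmulr_rgt0 _ (meas_gt0 G' (Phi b))) alpha_observed.
have /connectP[p pp ->] := conn b x.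
elim/last_ind: p pp => // p w IH; rewrite rcons_path last_rcons => /andP[/IH ap xw].
set x0 := last b p in ap xw *.
have : adj G' (Phi x0) (Phi w) by rewrite -matching_adj.
move/weight_gt0; rewrite matching_weight // pmulr_lgt0 ?weight_gt0 //.
rewrite pmulr_rgt0; last by rewrite mulr_gt0 ?meas_gt0.
by rewrite pmulr_rgt0 ?meas_gt0.
Qed.

(** Equal measures make [alpha x] the positive root of mu_x^2 alpha^2 = 1, so
    the kernels of A and A' coincide; their off-diagonal entries contain the
    weights and their diagonal entries then give the potential. *)
Lemma recovery_of_meas : bijective Phi ->
  (forall x, meas G' (Phi x) = meas G x) ->
  (forall x, q' (Phi x) = q x) /\
  (forall x y, adj G x y -> weight G' (Phi x) (Phi y) = weight G x y).
Proof.
move=> bij mE.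
have aE x : meas G x * alpha x = 1.
  have /eqP : (meas G x * alpha x) ^+ 2 = 1.
    by rewrite -(alpha_sqr x) mE; ring.
  by rewrite sqrp_eq1 ?mulr_ge0 ?(ltW (meas_gt0 _ _)) ?(ltW (alpha_gt0 _)) // => /eqP.
have wE x y : adj G x y -> weight G' (Phi x) (Phi y) = weight G x y.
  by move=> xy; rewrite matching_weight // !mE !aE !mul1r.
split=> // x; have := kern1_matching x x; rewrite !aE !mul1r.
rewrite (kern1_diag eig) (kern1_diag eig') mE.
rewrite (reindex Phi) /=; last exact: onW_bij.
have -> : \sum_(y | adj G' (Phi x) (Phi y)) weight G' (Phi x) (Phi y)
            = \sum_(y | adj G x y) weight G x y.
  by apply: eq_big => [y|y]; rewrite -matching_adj // => /wE.
by move/(mulIf (invr_neq0 (lt0r_neq0 (meas_gt0 G x))))/addIr.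
Qed.

(** The function [w] below is the adjoint of the unitary map applied to the
    constant 1. As A' kills 1 and the adjoint intertwines A' with A, [w] is
    harmonic, hence constant, with value 1 at the observed vertex. *)
Lemma meas_of_free : (forall x, q x = 0) -> (forall x, q' x = 0) ->
  forall x, meas G' (Phi x) = meas G x.
Proof.
move=> q0 q0' x.
pose w z := \sum_y meas G' y * a z y.
have wE z : w z = meas G' (Phi z) * alpha z.
  rewrite /w (bigD1 (Phi z)) //= big1 ?addr0 // => y yz.
  by rewrite (matched_row (PhiP z) yz) mulr0.
have harm z : laplacian G w z = 0.
  rewrite laplacian_sum -[RHS](total_laplacian G' (a z)); apply: eq_bigr => y _.
  congr (_ * _); apply: oppr_inj.
  (* Both sides are the mixed kernel of exponent 1, computed by applying A in
     the first variable or A' in the second one. *)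
  have := kernS eig phi' 0 z y; rewrite q0 mul0r addr0 => <-.
  rewrite kernC (kernS eig') q0' mul0r addr0; congr (- _).
  by rewrite /laplacian; congr (_ * _); apply: eq_bigr => t _; rewrite ![kern _ phi' _ _ _ _]kernC.
have w1 : meas G' (Phi x) * alpha x = 1.
  by rewrite -wE (harmonic_const conn harm x b) wE alpha_observed.
rewrite -[LHS]mulr1 -(alpha_sqr x).
transitivity (meas G x * (meas G' (Phi x) * alpha x) ^+ 2); first by ring.
by rewrite w1 expr1n mulr1.
Qed.

End Observed.

End Recovery.

Lemma iso_deg (R : realType) (X X' : finType) (G : wgraph R X) (G' : wgraph R X')
    (Phi : X -> X') x :
  graph_iso G G' Phi -> deg G' (Phi x) = deg G x.
Proof.
case=> bij adjE; rewrite /deg -(card_imset _ (bij_inj bij)).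
apply: eq_card => y; rewrite inE; case: bij => Psi PhiK PsiK.
rewrite -[y]PsiK -adjE mem_imset ?inE //; exact: can_inj PhiK.
Qed.

Theorem theorem1p3 (R : realType) (X X' : finType)
    (G : wgraph R X) (G' : wgraph R X') (q : X -> R) (q' : X' -> R)
    (B : {set X}) (B' : {set X'})
    (Phi0 : {x | x \in B} -> {x' | x' \in B'}) :
  connected_graph G -> connected_graph G' ->
  B != set0 -> B' != set0 ->
  two_points G B -> two_points G' B' ->
  bijective Phi0 ->
  spectral_data_coincide G G' q q' Phi0 ->
  exists Phi : X -> X',
    [/\ graph_iso G G' Phi,
        forall b : {x | x \in B}, Phi (val b) = val (Phi0 b),
        (((forall x, meas G x = (deg G x)%:R) /\
          (forall x', meas G' x' = (deg G' x')%:R)) \/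
         ((exists c, forall x, meas G x = c) /\
          (exists c', forall x', meas G' x' = c'))) ->
        [/\ forall x, meas G' (Phi x) = meas G x,
            forall x, q' (Phi x) = q x
          & forall x y, adj G x y -> weight G' (Phi x) (Phi y) = weight G x y]
      & (forall x, q x = 0) -> (forall x', q' x' = 0) ->
        (forall x, meas G' (Phi x) = meas G x) /\
        (forall x y, adj G x y -> weight G' (Phi x) (Phi y) = weight G x y)].
Proof.
move=> conn conn' Bn0 _ twop _ _ [cardX [lam [lam' [phi [phi' [eig eig0 lamE seen0]]]]]].
have eig' : eigenfamily G' q' lam phi'.
  by case: eig0 => o s h; split=> // j x; rewrite h lamE.
have seen b : b \in B -> exists b', forall j, phi j b = phi' j b'.
  by move=> bB; exists (val (Phi0 (exist _ b bB))) => j; apply: seen0 (exist _ b bB).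
have /fin_all_exists[Phi PhiP] := all_matched eig eig' conn conn' Bn0 twop seen.
have bij : bijective Phi.
  by apply: (inj_card_bij (matching_inj eig eig' PhiP)); rewrite cardX.
have iso : graph_iso G G' Phi.
  by split=> // x y; apply: (matching_adj eig eig' PhiP).
have /set0Pn[b bB] := Bn0; have [b' e] := seen b bB.
have rec := recovery_of_meas eig eig' conn PhiP e bij.
exists Phi; split=> // [[c cB]|meas_cond|q0 q0'].
- exact: (matching_observed eig' PhiP (seen0^~ (exist _ c cB))).
- suff mE : forall x, meas G' (Phi x) = meas G x by have [] := rec mE.
  move=> x; case: meas_cond => [[mE mE']|[[c mE] [c' mE']]].
    by rewrite mE mE' (iso_deg x iso).
  by have := meas_observed eig eig' PhiP e; rewrite !mE !mE'.
- have mE := meas_of_free eig eig' conn PhiP e q0 q0'.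
  by have [] := rec mE.
Qed.
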